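(* Let $(\epsilon,\mathbb D,\mathbb S)$ be a Pufferfish instantiation (with the data-generating process $G$ fixed). A data-release mechanism $M$ satisfies $(\epsilon,\mathbb D,\mathbb S)$ if and only if, for all $\theta_0\ne\theta_1\in\Theta$, the power $1-\beta$ of all size-$\alpha$ tests of $$H_0:\theta=\theta_0\quad\text{versus}\quad H_1:\theta=\theta_1$$ is bounded by the inequalities $$\max\big(\alpha/\phi,\;1-[1-\alpha]\phi\big)\le1-\beta\le\min\big(\alpha\phi,\;1-[1-\alpha]/\phi\big),$$ where $\phi=\exp[\epsilon\,d_{\mathbb D,\mathbb S}(\theta_0,\theta_1)]$.
   Context: $(\mathcal X,\mathscr G)$ (data universe) and $(\mathcal T,\mathscr F)$ are measurable spaces, and $\Theta$ is in one-to-one correspondence $\theta\leftrightarrow P_\theta$ with the set of all probability measures on $(\mathcal X,\mathscr G)$. The data-generating process is a map $G:\Theta\times[0,1]\to\mathcal X$ with $G(\theta,\cdot)$ measurable for each $\theta$ and $P_\theta(X\in E)=\lambda(\{u_1\in[0,1]:G(\theta,u_1)\in E\})$ for $E\in\mathscr G$ ($X=G(\theta,U_1)$, $\lambda$ Lebesgue measure). A data-release mechanism is a $(\mathscr G\otimes\mathcal B[0,1],\mathscr F)$-measurable $M:\mathcal X\times[0,1]\to\mathcal T$; $P_x(S)=\lambda(\{u\in[0,1]:M(x,u)\in S\})$. The data-provision procedure outputs $T=M(G(\theta,U_1),U_2)$ with $U_1,U_2$ i.i.d. $\mathrm{Unif}[0,1]$, and $P(T\in S\mid\theta)=\int_{\mathcal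 X}P_x(S)\,dP_\theta(x)$. For $\theta\in\Theta$ and $E\in\mathscr G$ for which the conditional distribution $P_\theta(X\in\cdot\mid X\in E)$ is well-defined, $\theta|_E\in\Theta$ is the unique parameter with $P_{\theta|_E}(X\in\cdot)=P_\theta(X\in\cdot\mid X\in E)$. (If $P_\theta(X\in E)>0$, this is the elementary conditional probability; if $X=(Y,Z)$ has a canonical density $f(y,z)$ with respect to a product measure $\mu_1\times\mu_2$ and $\{X\in E\}=\{Z=z_E\}$, it is the regular conditional probability with $\mu_1$-density $f(y,z_E)/\int f(y',z_E)\,d\mu_1(y')$ if the denominator is positive, and an arbitrary fixed $\mu_1$-density otherwise.) Only pairs for which these conditionals are well-defined are considered. A Pufferfish instantiation $(\epsilon,\mathbb D,\mathbb S)$ consists of a set $\mathbb D\subset\Theta$ (attackers), a set $\mathbb S\subset\mathscr G\times\mathscr G$ (pairs of competing conjectures) and $0\le\epsilon\le\infty$. Let $G_{\mathbb D,\mathbb S}$ be the (undirected) graph on $\Theta$ with an edge $(\theta,\theta')$ whenever there exist $\theta^*\in\mathbb D$ and $(E,E')\in\mathbb S$ with $\theta=\theta^*|_E$ and $\theta'=\theta^*|_{E'}$; $d_{\mathbb D,\mathbb S}(\theta,\theta')$ is the length of a shortest path in this graph ($\infty$ if there is none). With $d_{\mathrm{Mult}}(\mu,\nu)=\sup_{S\in\mathscr F}|\ln(\mu(S)/\nu(S))|$ ($0/0=\infty/\infty=1$), $M$ satisfies $(\epsilon,\mathbb D,\mathbb S)$ if $d_{\mathrm{Mult}}(P(T\in\cdot\mid\theta),P(T\in\cdot\mid\theta'))\le\epsilon\,d_{\mathbb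 D,\mathbb S}(\theta,\theta')$ for all $\theta,\theta'\in\Theta$, where $0\times\infty=\infty$. A test based on $T$ is given by a rejection region $R\in\mathscr F$; its size is $\alpha=P(T\in R\mid\theta_0)$ and its power is $1-\beta=P(T\in R\mid\theta_1)$. When $\phi=\infty$, $\alpha/\phi=[1-\alpha]/\phi=0$ and the convention $0\times\infty=\infty$ is used in $\alpha\phi$ and $[1-\alpha]\phi$ (so the inequalities are vacuous). *)

(* Defs.v *)
From HB Require Import structures.
From mathcomp Require Import all_boot all_order all_algebra.
From mathcomp Require Import all_classical all_reals all_analysis.

Set Implicit Arguments.
Unset Strict Implicit.
Unset Printing Implicit Defensive.

Import Order.TTheory GRing.Theory Num.Theory.
Import numFieldNormedType.Exports.

Local Open Scope classical_set_scope.
Local Open Scope ring_scope.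
Local Open Scope ereal_scope.

(* Product and ratio of nonnegative extended reals with 0 * oo = oo and
   0 / 0 = oo / oo = 1. The library has 0 * oo = 0 and 0^-1 = oo, hence
   0 / 0 = oo / oo = 0. *)
Definition mule_oo {R : realType} (x y : \bar R) : \bar R :=
  if (x == +oo) || (y == +oo) then +oo else x * y.

Definition dive_1 {R : realType} (x y : \bar R) : \bar R :=
  if (x == 0) && (y == 0) || (x == +oo) && (y == +oo) then 1 else x / y.

Definition d_mult {d} {T : measurableType d} {R : realType}
    (mu nu : set T -> \bar R) : \bar R :=
  ereal_sup [set `| lne (dive_1 (mu S) (nu S)) | | S in measurable].

(* A measure of the library is a function on all subsets, with unspecified
   values on the nonmeasurable ones, so "the same probability measure" has to
   mean equality on measurable sets. *)
Definition same_law {d} {X : measurableType d} {R : realType}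
    (P Q : set X -> \bar R) : Prop :=
  forall A, measurable A -> P A = Q A.

Definition parametrizes_probabilities {d} {X : measurableType d}
    {R : realType} {Theta : Type} (P : Theta -> probability X R) : Prop :=
  (forall t t', same_law (P t) (P t') -> t = t') /\
  (forall Q : probability X R, exists t, same_law (P t) Q).

Definition unit_interval (R : realType) : set R := `[0%R, 1%R]%classic.
Arguments unit_interval R : clear implicits.

(* Maps on [0, 1] are represented by maps on R whose values outside [0, 1]
   are never used. *)
Definition data_generating {d} {X : measurableType d} {R : realType}
    {Theta : Type} (P : Theta -> probability X R) (G : Theta -> R -> X) :
    Prop :=
  forall t, measurable_fun (unit_interval R) (G t) /\
    forall E, measurable E ->
      P t E = lebesgue_measure [set u : R | unit_interval R u /\ E (G t u)].

Definition release_mechanism {d d'} {X : measurableType d}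
    {T : measurableType d'} {R : realType} (M : X * R -> T) : Prop :=
  measurable_fun ([set: X] `*` unit_interval R) M.

Definition release_given_data {d d'} {X : measurableType d}
    {T : measurableType d'} {R : realType} (M : X * R -> T) (x : X)
    (S : set T) : \bar R :=
  lebesgue_measure [set u : R | unit_interval R u /\ S (M (x, u))].

Definition release_law {d d'} {X : measurableType d} {T : measurableType d'}
    {R : realType} {Theta : Type} (P : Theta -> probability X R)
    (M : X * R -> T) (t : Theta) (S : set T) : \bar R :=
  \int[P t]_x release_given_data M x S.

(* A way of writing X = (Y, Z), together with the densities with respect to
   mu1 \x mu2 chosen as canonical for those parameters that have one, and the
   fixed mu1-density used where the marginal density of Z vanishes. *)
Record canonical_rep {d} {X : measurableType d} {R : realType} {Theta : Type}
    (P : Theta -> probability X R) := CanonicalRep {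
  rep_dY : measure_display ;
  rep_dZ : measure_display ;
  rep_Y : measurableType rep_dY ;
  rep_Z : measurableType rep_dZ ;
  rep_split : X -> rep_Y * rep_Z ;
  rep_join : rep_Y * rep_Z -> X ;
  rep_splitK : cancel rep_split rep_join ;
  rep_joinK : cancel rep_join rep_split ;
  rep_split_meas : measurable_fun setT rep_split ;
  rep_join_meas : measurable_fun setT rep_join ;
  rep_mu1 : {sigma_finite_measure set rep_Y -> \bar R} ;
  rep_mu2 : {sigma_finite_measure set rep_Z -> \bar R} ;
  rep_density : Theta -> option (rep_Y * rep_Z -> R) ;
  rep_densityP : forall t f, rep_density t = Some f ->
    [/\ measurable_fun setT f, forall w, (0 <= f w)%R &
        forall A, measurable A ->
          P t (rep_split @^-1` A) = \int[rep_mu1 \x rep_mu2]_(w in A) (f w)%:E] ;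
  rep_default : rep_Y -> R ;
  rep_default_meas : measurable_fun setT rep_default ;
  rep_default_ge0 : forall y, (0 <= rep_default y)%R ;
  rep_default_int : \int[rep_mu1]_y (rep_default y)%:E = 1
}.

Arguments rep_split {d X R Theta P} c.
Arguments rep_join {d X R Theta P} c.

Definition rep_marginal {d} {X : measurableType d} {R : realType}
    {Theta : Type} {P : Theta -> probability X R} (r : canonical_rep P)
    (f : rep_Y r * rep_Z r -> R) (z : rep_Z r) : \bar R :=
  \int[rep_mu1 r]_y (f (y, z))%:E.

(* An infinite marginal gives the zero function, hence no conditional
   probability. *)
Definition rep_cond_density {d} {X : measurableType d} {R : realType}
    {Theta : Type} {P : Theta -> probability X R} (r : canonical_rep P)
    (f : rep_Y r * rep_Z r -> R) (z : rep_Z r) (y : rep_Y r) : \bar R :=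
  if 0 < rep_marginal f z then (f (y, z))%:E / rep_marginal f z
  else (rep_default y)%:E.

Definition elementary_conditional {d} {X : measurableType d} {R : realType}
    (P : probability X R) (E : set X) (Q : set X -> \bar R) : Prop :=
  0 < P E /\ same_law Q (fun A => P (A `&` E) / P E).

Definition regular_conditional {d} {X : measurableType d} {R : realType}
    {Theta : Type} {P : Theta -> probability X R} (r : canonical_rep P)
    (t : Theta) (E : set X) (Q : set X -> \bar R) : Prop :=
  exists f z, [/\ rep_density r t = Some f,
    E = [set x | (rep_split r x).2 = z] &
    same_law Q (fun A => \int[rep_mu1 r]_(y in [set y | A (rep_join r (y, z))])
                           rep_cond_density f z y)].

(* [C] is the collection of canonical representations in force. *)
Definition conditional_law {d} {X : measurableType d} {R : realType}
    {Theta : Type} {P : Theta -> probability X R} (C : canonical_rep P -> Prop)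
    (t : Theta) (E : set X) (Q : set X -> \bar R) : Prop :=
  elementary_conditional (P t) E Q \/
  exists r, C r /\ regular_conditional r t E Q.

(* [t'] is t|_E. The uniqueness clause makes t|_E undefined when the
   representations in [C] disagree (Borel-Kolmogorov). *)
Definition conditioned {d} {X : measurableType d} {R : realType}
    {Theta : Type} {P : Theta -> probability X R} (C : canonical_rep P -> Prop)
    (t : Theta) (E : set X) (t' : Theta) : Prop :=
  unique (fun s => conditional_law C t E (P s)) t'.

Record pufferfish {d} (X : measurableType d) (R : realType) (Theta : Type) :=
  Pufferfish {
  puf_eps : \bar R ;
  puf_eps_ge0 : 0 <= puf_eps ;
  puf_attackers : set Theta ;
  puf_conjectures : set (set X * set X) ;
  puf_conjectures_meas : forall E E', puf_conjectures (E, E') ->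
    measurable E /\ measurable E'
}.

Definition puf_edge {d} {X : measurableType d} {R : realType} {Theta : Type}
    {P : Theta -> probability X R} (C : canonical_rep P -> Prop)
    (I : pufferfish X R Theta) (t t' : Theta) : Prop :=
  exists ts E E', [/\ puf_attackers I ts, puf_conjectures I (E, E') &
    (conditioned C ts E t /\ conditioned C ts E' t') \/
    (conditioned C ts E t' /\ conditioned C ts E' t)].

Definition graph_dist {R : realType} {V : Type} (e : V -> V -> Prop) (x y : V) :
    \bar R :=
  ereal_inf [set (size p)%:R%:E |
             p in [set p : seq V | path (fun a b => `[< e a b >]) x p /\
                                   last x p = y]].

Definition puf_dist {d} {X : measurableType d} {R : realType} {Theta : Type}
    {P : Theta -> probability X R} (C : canonical_rep P -> Prop)
    (I : pufferfish X R Theta) (t t' : Theta) : \bar R :=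
  graph_dist (puf_edge C I) t t'.

Definition satisfies {d d'} {X : measurableType d} {T : measurableType d'}
    {R : realType} {Theta : Type} {P : Theta -> probability X R}
    (C : canonical_rep P -> Prop) (I : pufferfish X R Theta)
    (M : X * R -> T) : Prop :=
  forall t t', d_mult (release_law P M t) (release_law P M t')
               <= mule_oo (puf_eps I) (puf_dist C I t t').

(* Main.v *)
Require Import Defs.
From HB Require Import structures.
From mathcomp Require Import all_boot all_order all_algebra.
From mathcomp Require Import all_classical all_reals all_analysis.
From mathcomp Require Import measurable_realfun.

(** The bound on [d_mult] says that for every measurable [S] the two laws
    satisfy mu S <= phi * nu S and nu S <= phi * mu S, which is exactly
    alpha / phi <= 1 - beta <= alpha * phi for the test rejecting on [S]. The
    two remaining bounds on the power are the same ones for the complementary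
    rejection region, because release laws have total mass 1.
    [abse_lne_dive1_le] translates the logarithmic bound on one event into
    linear inequalities, [release_lawC] supplies the mass of the complement,
    and [power_bounds] rewrites the inequalities of the theorem over the reals.
    When the exponent is infinite, [d_mult] is not constrained, and the power
    bounds only say that the power lies in [0, 1]. Equal parameters, which the
    tests leave out, have [d_mult] equal to 0. *)

Set Implicit Arguments.
Unset Strict Implicit.
Unset Printing Implicit Defensive.

Import Order.TTheory GRing.Theory Num.Theory.
Import numFieldNormedType.Exports.

Local Open Scope classical_set_scope.
Local Open Scope ring_scope.
Local Open Scope ereal_scope.

Section release_law_probability.
Context {R : realType} {dX dT : measure_display}.
Context {X : measurableType dX} {T : measurableType dT}.
Variables (M : X * R -> T) (HM : release_mechanism M).

Lemma measurable_unit_interval : measurable (unit_interval R).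
Proof. exact: measurable_itv. Qed.

Lemma lebesgue_measure_unit_interval :
  lebesgue_measure (unit_interval R) = 1.
Proof. by rewrite lebesgue_measure_itv /= lte_fin ltr01 -EFinB subr0. Qed.

Lemma release_given_data_ge0 x (S : set T) : 0 <= release_given_data M x S.
Proof. exact: measure_ge0. Qed.

(** The set of pairs (x, u) at which the mechanism releases a value in [S] is
    measurable; [release_given_data M x S] is the measure of its section at
    [x], hence a measurable function of [x]. *)
Lemma measurable_release_event (S : set T) : measurable S ->
  measurable (([set: X] `*` unit_interval R) `&` M @^-1` S).
Proof.
move=> mS; apply: HM => //; apply: measurableX => //.
exact: measurable_unit_interval.
Qed.

Lemma xsection_release_event x (S : set T) :
  [set u : R | unit_interval R u /\ S (M (x, u))] =
  xsection (([set: X] `*` unit_interval R) `&` M @^-1` S) x.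
Proof.
apply/seteqP; split=> u /=.
  by move=> [uI Su]; apply/xsectionP; do !split.
by move/xsectionP => [[_ uI] Su].
Qed.

Lemma measurable_release_section x (S : set T) : measurable S ->
  measurable [set u : R | unit_interval R u /\ S (M (x, u))].
Proof.
move=> mS; rewrite xsection_release_event; apply: measurable_xsection.
exact: measurable_release_event.
Qed.

Lemma measurable_release_given_data (S : set T) : measurable S ->
  measurable_fun [set: X] (fun x => release_given_data M x S).
Proof.
move=> mS.
have -> : (fun x => release_given_data M x S) =
    @lebesgue_measure R \o
      xsection (([set: X] `*` unit_interval R) `&` M @^-1` S).
  by apply/funext => x; rewrite /release_given_data xsection_release_event.
by apply: measurable_fun_xsection; exact: measurable_release_event.
Qed.

Lemma release_given_dataC x (S : set T) : measurable S ->
  release_given_data M x S + release_given_data M x (~` S) = 1.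
Proof.
move=> mS; rewrite /release_given_data -measureU.
- rewrite (_ : _ `|` _ = unit_interval R).
    exact: lebesgue_measure_unit_interval.
  apply/seteqP; split=> u /=; first by move=> [[]|[]].
  by move=> uI; have [Su|Su] := pselect (S (M (x, u))); [left|right].
- exact: measurable_release_section.
- by apply: measurable_release_section; exact: measurableC.
- by apply/seteqP; split=> // u [/= [_ Su] [_ nSu]].
Qed.

Variables (Theta : Type) (P : Theta -> probability X R).

Lemma release_law_ge0 t (S : set T) : 0 <= release_law P M t S.
Proof. by apply: integral_ge0 => x _; exact: release_given_data_ge0. Qed.

Lemma release_lawC t (S : set T) : measurable S ->
  release_law P M t S + release_law P M t (~` S) = 1.
Proof.
move=> mS; rewrite /release_law -ge0_integralD //.
- under eq_integral do rewrite release_given_dataC//.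
  by rewrite integral_cst // mul1e; exact: probability_setT.
- exact: measurable_release_given_data.
- by apply: measurable_release_given_data; exact: measurableC.
Qed.

Lemma release_law_fin_num t (S : set T) : measurable S ->
  release_law P M t S \is a fin_num.
Proof.
move=> mS; rewrite ge0_fin_numE ?release_law_ge0//.
rewrite (@le_lt_trans _ _ 1) ?ltry// -(release_lawC t mS).
by rewrite leeDl ?release_law_ge0.
Qed.

End release_law_probability.

Section log_ratio.
Context {R : realType}.
Implicit Types a b D : R.

(** The hypothesis on [D] matters only for a = b = 0, where the ratio is 1. *)
Lemma abse_lne_dive1_le a b D : (0 <= a)%R -> (0 <= b)%R -> (0 <= D)%R ->
  (`|lne (dive_1 a%:E b%:E)| <= D%:E) =
  (a <= b * expR D)%R && (b <= a * expR D)%R.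
Proof.
move=> a0 b0 D0; rewrite /dive_1 !eqe /= orbF.
have [->|an0] := eqVneq a 0%R; have [->|bn0] := eqVneq b 0%R.
- by rewrite lne1 abse0 lee_fin D0 !mul0r lexx.
- rewrite [0%R%:E / _]mul0e /= lexx /= leye_eq /= mul0r.
  by rewrite [(b <= 0)%R]leNgt lt_def bn0 b0 andbF.
- rewrite inver eqxx gt0_muley ?lte_fin ?lt_def ?an0//= leye_eq mul0r.
  by rewrite leNgt lt_def an0 a0.
- have ap : (0 < a)%R by rewrite lt_def an0.
  have bp : (0 < b)%R by rewrite lt_def bn0.
  rewrite inver (negbTE bn0) -EFinM lne_EFin ?divr_gt0// lee_fin ler_norml andbC.
  congr (_ && _).
    by rewrite -[X in X = _]ler_expR lnK ?posrE ?divr_gt0// ler_pdivrMr// mulrC.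
  rewrite -[X in X = _]ler_expR lnK ?posrE ?divr_gt0// expRN.
  by rewrite ler_pdivlMr// mulrC ler_pdivrMr ?expR_gt0.
Qed.

Lemma dive1_ee a : dive_1 a%:E a%:E = 1.
Proof.
rewrite /dive_1 andbb orbF; case: eqVneq => //= a0.
by rewrite divee.
Qed.

(** The first two real inequalities bound the ratio of the probabilities [a]
    and [b] of an event, the last two that of the complementary event. *)
Lemma power_bounds (D a b : R) (e := expR D) :
  (maxe (a%:E / expeR D%:E) (1 - mule_oo (1 - a)%:E (expeR D%:E)) <= b%:E /\
   b%:E <= mine (mule_oo a%:E (expeR D%:E)) (1 - (1 - a)%:E / expeR D%:E)) <->
  [/\ (a <= b * e)%R, (b <= a * e)%R,
      (1 - b <= (1 - a) * e)%R & (1 - a <= (1 - b) * e)%R].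
Proof.
rewrite /mule_oo /= inver (gt_eqF (expR_gt0 D)) ge_max le_min.
rewrite -!EFinM -!EFinB !lee_fin -/e ler_pdivrMr ?expR_gt0//.
have -> : (1 - (1 - a) * e <= b)%R = (1 - b <= (1 - a) * e)%R.
  by rewrite lerBlDr lerBlDl.
have -> : (b <= 1 - (1 - a) / e)%R = (1 - a <= (1 - b) * e)%R.
  by rewrite lerBrDr -lerBrDl ler_pdivrMr ?expR_gt0.
by split=> [[/andP[? ?] /andP[? ?]]|[? ? ? ?]]; split=> //; apply/andP.
Qed.

End log_ratio.

Section pufferfish_distance.
Context {R : realType}.

Lemma graph_dist_ge0 (V : Type) (e : V -> V -> Prop) x y :
  0 <= graph_dist e x y :> \bar R.
Proof. by apply: le_ereal_inf_tmp => _ [p _ <-]; rewrite lee_fin ler0n. Qed.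

Lemma mule_oo_ge0 (x y : \bar R) : 0 <= x -> 0 <= y -> 0 <= mule_oo x y.
Proof. by rewrite /mule_oo => x0 y0; case: ifP => // _; rewrite mule_ge0. Qed.

Lemma mule_oo_puf_ge0 {d} {X : measurableType d} {Theta : Type}
    {P : Theta -> probability X R} (C : canonical_rep P -> Prop)
    (I : pufferfish X R Theta) t t' :
  0 <= mule_oo (puf_eps I) (puf_dist C I t t').
Proof. by rewrite mule_oo_ge0 ?puf_eps_ge0 ?graph_dist_ge0. Qed.

End pufferfish_distance.

Theorem theorem25 (R : realType) (dX dT : measure_display)
    (X : measurableType dX) (T : measurableType dT) (Theta : Type)
    (P : Theta -> probability X R) (HP : parametrizes_probabilities P)
    (G : Theta -> R -> X) (HG : data_generating P G)
    (C : canonical_rep P -> Prop)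
    (I : pufferfish X R Theta)
    (M : X * R -> T) (HM : release_mechanism M) :
  satisfies C I M <->
  (forall t0 t1 : Theta, t0 <> t1 ->
   let phi := expeR (mule_oo (puf_eps I) (puf_dist C I t0 t1)) in
   forall (alpha beta : R) (rejection : set T), measurable rejection ->
     release_law P M t0 rejection = alpha%:E ->
     release_law P M t1 rejection = (1 - beta)%:E ->
     maxe (alpha%:E / phi) (1 - mule_oo (1 - alpha)%:E phi) <= (1 - beta)%:E /\
     (1 - beta)%:E <= mine (mule_oo alpha%:E phi) (1 - (1 - alpha)%:E / phi)).
Proof.
split=> [sat t0 t1 _ phi a b S mS La Lb|pow t0 t1].
- have := sat t0 t1; have := mule_oo_puf_ge0 C I t0 t1; rewrite /phi.
  have b0 : 0 <= (1 - b)%:E by rewrite -Lb release_law_ge0.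
  have LaC : release_law P M t0 (~` S) = (1 - a)%:E.
    rewrite EFinB -La -(release_lawC HM P t0 mS) addeAC.
    by rewrite subee ?add0e ?release_law_fin_num.
  have LbC : release_law P M t1 (~` S) = (1 - (1 - b))%:E.
    rewrite EFinB -Lb -(release_lawC HM P t1 mS) addeAC.
    by rewrite subee ?add0e ?release_law_fin_num.
  have bC0 : 0 <= (1 - (1 - b))%:E by rewrite -LbC release_law_ge0.
  case: (mule_oo _ _) => [D| |//] D0 dD; last first.
    rewrite [expeR +oo]/= /mule_oo !eqxx !orbT invey !mule0 sube0.
    rewrite ge_max le_min b0 leNye leey; split=> //.
    by move: bC0; rewrite !lee_fin subr_ge0.
  have ratio A p q : measurable A -> release_law P M t0 A = p%:E ->
      release_law P M t1 A = q%:E ->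
      (p <= q * expR D)%R && (q <= p * expR D)%R.
    move=> mA Lp Lq; rewrite -abse_lne_dive1_le.
    + by apply: le_trans dD; rewrite -Lp -Lq; apply: ereal_sup_ubound; exists A.
    + by rewrite -lee_fin -Lp release_law_ge0.
    + by rewrite -lee_fin -Lq release_law_ge0.
    + by rewrite -lee_fin.
  apply/power_bounds.
  have /andP[h1 h2] := ratio _ _ _ mS La Lb.
  by have /andP[h3 h4] := ratio _ _ _ (measurableC mS) LaC LbC.
- apply: ge_ereal_sup => _ [S mS <-].
  have [a La] : exists a, release_law P M t0 S = a%:E.
    by eexists; apply/esym/fineK/release_law_fin_num.
  have [b Lb] : exists b, release_law P M t1 S = b%:E.
    by eexists; apply/esym/fineK/release_law_fin_num.
  have D_ge0 := mule_oo_puf_ge0 C I t0 t1.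
  have [t01|neq] := pselect (t0 = t1).
    by rewrite -t01 La dive1_ee lne1 abse0 t01 mule_oo_puf_ge0.
  have a0 : (0 <= a)%R by rewrite -lee_fin -La release_law_ge0.
  have b0 : (0 <= b)%R by rewrite -lee_fin -Lb release_law_ge0.
  have := pow t0 t1 neq a (1 - b)%R S mS.
  rewrite /= subKr La Lb => /(_ erefl erefl); move: D_ge0.
  case: (mule_oo _ _) => [D| |//] D0; last by rewrite leey.
  move=> /power_bounds[h1 h2 _ _].
  by rewrite abse_lne_dive1_le // h1.
Qed.
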